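(* Let $p$ be a prime, $f\ge 1$ and $m\ge 3$ integers, and $q=p^f$. Let $C_0$ be a subgroup of $\mathbb{F}_{q^m}^\ast$ with $\mathbb{F}_q^\ast\le C_0$, $[\mathbb{F}_{q^m}^\ast:C_0]=e$, $-C_0=C_0$, and suppose that the Cayley graph $\mathrm{Cay}(\mathbb{F}_{q^m},C_0)$ is strongly regular. Let $\gamma$ be a primitive element of $\mathbb{F}_{q^{2m}}$ and $\omega=\gamma^{q^m+1}$ (a primitive element of $\mathbb{F}_{q^m}$), so that the cosets of $C_0$ in $\mathbb{F}_{q^m}^\ast$ are $\omega^iC_0$, $0\le i\le e-1$. Let $H_0=\{x\mathbb{F}_q^\ast : x\in\mathbb{F}_{q^m}^\ast,\ \mathrm{Tr}_{q^m/q}(x)=0\}\subseteq \mathbb{F}_{q^m}^\ast/\mathbb{F}_q^\ast$ (the Singer difference set), and for a subset $X\subseteq\mathbb{F}_{q^m}^\ast$ let $\overline{X}=\{x\mathbb{F}_q^\ast: x\in X\}$. Define $$I=\{0\le i\le e-1 : |H_0\cap \overline{\omega^iC_0}|\neq |H_0\cap\overline{C_0}|\}$$ and $D=\bigcup_{i\in I}\gamma^i\langle\gamma^e\rangle\subseteq\mathbb{F}_{q^{2m}}$. Then $\mathrm{Cay}(\mathbb{F}_{q^{2m}},D)$ is strongly regular.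
   Context: For an additive abelian group $G$ and a subset $D\subseteq G$ with $0\notin D$ and $-D=D$, the Cayley graph $\mathrm{Cay}(G,D)$ has vertex set $G$, with $x,y$ adjacent iff $x-y\in D$. $\mathrm{Tr}_{q^m/q}$ denotes the trace map from $\mathbb{F}_{q^m}$ to $\mathbb{F}_q$. (Under the hypotheses, the numbers $|H_0\cap\overline{\omega^iC_0}|$, $0\le i\le e-1$, take exactly two values.) *)

(* Defs.v *)
From HB Require Import structures.
From mathcomp Require Import all_boot all_order all_algebra all_fingroup.
From mathcomp Require Import all_solvable all_field.

Set Implicit Arguments.
Unset Strict Implicit.
Unset Printing Implicit Defensive.

Import GroupScope GRing.Theory.
Local Open Scope ring_scope.

(* The graph is simple, neither complete nor edgeless; it may be disconnected
   (mu = 0 is allowed). *)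
Definition srg (T : finType) (e : rel T) (k lambda mu : nat) : Prop :=
  [/\ irreflexive e /\ symmetric e,
      (exists x y, e x y) /\ (exists x y, x != y /\ ~~ e x y),
      forall x, #|[set y | e x y]| = k,
      forall x y, e x y -> #|[set z | e x z & e y z]| = lambda
    & forall x y, x != y -> ~~ e x y -> #|[set z | e x z & e y z]| = mu].

Definition strongly_regular (T : finType) (e : rel T) : Prop :=
  exists k lambda mu, srg e k lambda mu.

(* The usual requirements 0 \notin D and - D = D amount to [cayley D] being
   irreflexive and symmetric, which [srg] demands. *)
Definition cayley (G : finZmodType) (D : {set G}) : rel G :=
  fun x y => x - y \in D.

Definition uset (R : finUnitRingType) (A : {set {unit R}}) : {set R} :=
  [set FinRing.uval u | u in A].

Section Singer.

(* [finvect_type K] is K itself, seen as a finite field as well as a splitting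
   field over F. *)
Variables (F : finFieldType) (K : fieldExtType F).

Definition base_units : {set {unit finvect_type K}} :=
  [set u : {unit finvect_type K} | FinRing.uval u \in 1%VS].

Lemma base_units_group_set : group_set base_units.
Proof.
apply/group_setP; split; first by rewrite inE rpred1.
by move=> u v; rewrite !inE => uF vF; rewrite rpredM.
Qed.

Canonical base_units_group := Group base_units_group_set.

(* The unit group is abelian, so for any set A of units, A / base_units is
   exactly the set of cosets of base_units by elements of A. *)
Definition singer_set : {set coset_of base_units} :=
  ([set u : {unit finvect_type K} |
     galTrace 1 {: finvect_type K} (FinRing.uval u) == 0] / base_units)%g.

End Singer.

(* Main.v *)
Require Import Defs.
From HB Require Import structures.
From mathcomp Require Import all_boot all_order all_algebra all_fingroup.
From mathcomp Require Import all_solvable all_field all_character.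
From mathcomp Require Import ring zify.

Set Implicit Arguments.
Unset Strict Implicit.
Unset Printing Implicit Defensive.

Import GroupScope GRing.Theory Num.Theory.
Local Open Scope ring_scope.

(* Write Q = q^m, K = F_Q, L = F_(Q^2), let psi be an additive character of K
   of the form chi o Tr_(K/F), and eta y = sum_(s in C0) psi (y s).  Summing psi
   over F*-orbits gives (q - 1) eta (omega^i) = q N_i - |C0|, where N_i is the
   number of trace-zero elements of omega^i C0; hence D is the preimage under
   the norm L -> K of E = {y != 0 | eta y != eta 1}.  A Cayley graph is strongly
   regular iff its nontrivial eigenvalues take at most two values, so eta takes
   exactly two values on K*, alpha = eta 1 and beta.  For all t, n in K, the
   number of x in L with trace t and norm n plus the number of (u, v) in K x K
   with u + v = t and u v = n is 2; therefore the eigenvalue of D at a is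
   - sum_(u, v) [u v / c in E] psi (u + v) with c = N a.  Averaging over
   C0 x C0 and using orthogonality, this is
   - (Q eta c + |C0| - alpha) / (beta - alpha), which takes two values
   (this replaces the Davenport-Hasse lifting of Gauss sums). *)

(** * Existence of nontrivial additive characters *)

Definition additive_char (R : finFieldType) (psi : R -> algC) : Prop :=
  [/\ psi 0 = 1, {morph psi : x y / x + y >-> x * y} & exists x, psi x != 1].

(** The additive group is abelian, so its irreducible characters are linear and as many as its
    elements; hence some irreducible character is not the principal one. *)
Lemma exists_additive_char (R : finFieldType) :
  exists psi : R -> algC, additive_char psi.
Proof.
have abR : abelian [set: R] by apply/centsP=> x _ y _; apply: addrC.
have /card_gt1P[i [j [_ _ ij]]] : (1 < #|Iirr [set: R]|)%N.
  by rewrite card_Iirr_abelian // cardsT finNzRing_gt1.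
have [k k0] : exists k : Iirr [set: R], k != 0.
  by have [i0|] := eqVneq i 0; [exists j; rewrite -i0 eq_sym | exists i].
have /char_abelianP/(_ k) lin := abR.
exists 'chi_k; split.
- exact: (lin_char1 lin).
- by move=> x y; apply: (lin_charM lin); rewrite inE.
apply/existsP; apply: contraR k0; rewrite negb_exists => /forallP chi1.
rewrite -irr_eq1; apply/eqP/cfunP=> x.
by rewrite cfun1E inE; apply/eqP; move: (chi1 x); rewrite negbK.
Qed.

(** * Fourier analysis and the eigenvalues of Cayley graphs *)

Section AdditiveCharacter.

Variables (R : finFieldType) (psi : R -> algC).
Hypothesis psiP : additive_char psi.

Let psi0 : psi 0 = 1. Proof. by case: psiP. Qed.
Let psiD (x y : R) : psi (x + y) = psi x * psi y. Proof. by case: psiP. Qed.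

(** Orthogonality: for a != 0, translating x by a^-1 x0 multiplies the sum by psi x0 != 1, so the
    sum vanishes. *)
Lemma additive_char_sum (a : R) :
  \sum_x psi (a * x) = if a == 0 then #|R|%:R else 0.
Proof.
have [->|a0] := eqVneq.
  by rewrite (eq_bigr (fun=> 1)) ?sumr_const // => x _; rewrite mul0r.
have [_ _ [x0 nx0]] := psiP.
have E : psi x0 * \sum_x psi (a * x) = \sum_x psi (a * x).
  rewrite mulr_sumr [RHS](reindex_inj (addrI (a^-1 * x0))).
  by apply: eq_bigr => x _; rewrite -psiD mulrDr mulVKf.
apply/eqP; move/eqP: E; rewrite -subr_eq0 -{2}[\sum_x _]mul1r -mulrBl mulf_eq0.
by rewrite subr_eq0 (negPf nx0).
Qed.

Lemma card_finField_neq0 : #|R|%:R != 0 :> algC.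
Proof. by rewrite pnatr_eq0 -lt0n (ltn_trans _ (finNzRing_gt1 R)). Qed.

(** Fourier inversion recovers [g z] from its coefficients, and only the one at a = 0 survives; its
    contribution does not depend on z. *)
Lemma fourier_const (g : R -> algC) :
  (forall a : R, a != 0 -> \sum_x g x * psi (a * x) = 0) -> forall x y, g x = g y.
Proof.
move=> g0; suff gE z : #|R|%:R * g z = \sum_x g x.
  by move=> x y; apply: (mulfI card_finField_neq0); rewrite !gE.
transitivity (\sum_a psi (- a * z) * \sum_x g x * psi (a * x)).
  transitivity (\sum_x g x * \sum_a psi ((x - z) * a)).
    rewrite (bigD1 z) //= subrr additive_char_sum eqxx big1 ?addr0 1?mulrC //.
    by move=> x xz; rewrite additive_char_sum subr_eq0 (negPf xz) mulr0.
  under eq_bigr do rewrite mulr_sumr.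
  rewrite exchange_big; apply: eq_bigr => a _; rewrite mulr_sumr.
  apply: eq_bigr => x _; rewrite mulrCA -psiD; congr (_ * psi _); ring.
rewrite (bigD1 0) //= [X in _ + X]big1; last by move=> a a0; rewrite g0 ?mulr0.
rewrite oppr0 mul0r psi0 mul1r addr0.
by apply: eq_bigr => x _; rewrite mul0r psi0 mulr1.
Qed.

(** The eigenvalue of [cayley D] belonging to the character x |-> psi (a x). *)
Definition fourier_set (D : {set R}) (a : R) : algC := \sum_(d in D) psi (a * d).

Lemma fourier_indicator (D : {set R}) (a : R) :
  \sum_x (x \in D)%:R * psi (a * x) = fourier_set D a.
Proof.
rewrite /fourier_set [RHS]big_mkcond; apply: eq_bigr => x _.
by case: (x \in D); rewrite ?mul1r ?mul0r.
Qed.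

(** The number of ways to write z as a difference of two elements of D, namely z - w and - w. *)
Definition diff_count (D : {set R}) (z : R) : nat :=
  #|[set w | z - w \in D & - w \in D]|.

Lemma card_common_nbr (D : {set R}) x y :
  #|[set z | cayley D x z & cayley D y z]| = diff_count D (x - y).
Proof.
rewrite /diff_count -[RHS](card_imset _ (addrI y)); apply: eq_card => z.
rewrite inE /cayley; apply/andP/imsetP => [[xz yz]|[w + ->]].
  exists (z - y); last by rewrite subrKC.
  rewrite inE; apply/andP; split.
    by have -> : x - y - (z - y) = x - z by ring.
  by rewrite opprB.
rewrite inE => /andP[h1 h2]; split.
  by have -> : x - (y + w) = x - y - w by ring.
by have -> : y - (y + w) = - w by ring.
Qed.

(** For symmetric D, [diff_count D] is the convolution of the indicator of D with itself, so its
    transform is a square. *)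
Lemma fourier_diff_count (D : {set R}) (a : R) :
  (forall d, (- d \in D) = (d \in D)) ->
  \sum_z (diff_count D z)%:R * psi (a * z) = fourier_set D a ^+ 2.
Proof.
move=> symD.
transitivity (\sum_z \sum_w ((z - w \in D) && (w \in D))%:R * psi (a * z)).
  apply: eq_bigr => z _; rewrite -mulr_suml; congr (_ * _).
  rewrite /diff_count -sum1_card natr_sum big_mkcond.
  by apply: eq_bigr => w _; rewrite inE symD; case: (_ && _).
rewrite exchange_big expr2 -[X in _ * X]fourier_indicator mulr_sumr.
apply: eq_bigr => w _.
rewrite (reindex_inj (addIr w)) -fourier_indicator mulr_suml.
apply: eq_bigr => d _; rewrite addrK mulrDr psiD.
by case: (d \in D); case: (w \in D); rewrite ?mul0r ?mulr0 ?mul1r.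
Qed.

Lemma fourier_delta (a : R) : \sum_x (x == 0)%:R * psi (a * x) = 1.
Proof.
rewrite (bigD1 0) //= big1 ?addr0 ?eqxx ?mulr0 ?psi0 ?mulr1 //.
by move=> x /negPf->; rewrite mul0r.
Qed.

Lemma cayley_sym (D : {set R}) d :
  symmetric (cayley D) -> (- d \in D) = (d \in D).
Proof. by move/(_ 0 d); rewrite /cayley sub0r subr0. Qed.

(** This is the adjacency identity A^2 = k I + l A + mu (J - I - A) read at a nontrivial character,
    where J contributes 0. *)
Lemma srg_fourier_quadratic (D : {set R}) k l mu (a : R) :
  srg (cayley D) k l mu -> a != 0 ->
  fourier_set D a ^+ 2
    = k%:R + l%:R * fourier_set D a + mu%:R * (- 1 - fourier_set D a).
Proof.
case=> [[irr sym] _ degD adjD nadjD] a0.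
have symD d := cayley_sym d sym.
have D0 : 0 \notin D by move: (irr 0); rewrite /cayley subr0 => ->.
rewrite -fourier_diff_count //.
have cE z : (diff_count D z)%:R
    = k%:R * (z == 0)%:R + l%:R * (z \in D)%:R
      + mu%:R * (1 - (z == 0)%:R - (z \in D)%:R) :> algC.
  have [->|z0] := eqVneq z 0.
    rewrite (negPf D0) -[0 in LHS](subrr 0) -card_common_nbr.
    under eq_finset do rewrite andbb.
    by rewrite degD /=; ring.
  have [zD|zD] := boolP (z \in D); rewrite -[z in LHS]subr0 -card_common_nbr.
    by rewrite adjD /cayley ?subr0 //=; ring.
  by rewrite nadjD /cayley ?subr0 //=; ring.
under eq_bigr do rewrite cE.
transitivity (\sum_x (k%:R - mu%:R) * ((x == 0)%:R * psi (a * x))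
  + \sum_x (l%:R - mu%:R) * ((x \in D)%:R * psi (a * x))
  + \sum_x mu%:R * psi (a * x)).
  by rewrite -!big_split; apply: eq_bigr => x _ /=; ring.
rewrite -!mulr_sumr fourier_delta fourier_indicator additive_char_sum (negPf a0).
by ring.
Qed.

(** Converse of the quadratic relation. The elements [d0] and [z0] show that the graph is neither
    edgeless nor complete, and their difference counts serve as lambda and mu. *)
Lemma two_eigenvalues_srg (D : {set R}) (s t : algC) d0 z0 :
  (forall d, (- d \in D) = (d \in D)) -> 0 \notin D ->
  d0 \in D -> z0 != 0 -> z0 \notin D ->
  (forall a : R, a != 0 -> (fourier_set D a - s) * (fourier_set D a - t) = 0) ->
  strongly_regular (cayley D).
Proof.
move=> symD D0 d0D z0n0 z0D eigD.
(* The transform of [g] at a is (eigenvalue - s)(eigenvalue - t), which is 0 for a != 0; so [g] is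
   constant and [diff_count D] is constant on D and on the nonzero elements outside D. *)
pose g z := (diff_count D z)%:R - (s + t) * (z \in D)%:R
            + s * t * (z == 0)%:R : algC.
have gC : forall x y, g x = g y.
  apply: fourier_const => a a0; rewrite -[RHS](eigD a a0) /g.
  transitivity (\sum_x (diff_count D x)%:R * psi (a * x)
    + \sum_x (- (s + t)) * ((x \in D)%:R * psi (a * x))
    + \sum_x s * t * ((x == 0)%:R * psi (a * x))).
    by rewrite -!big_split; apply: eq_bigr => x _ /=; ring.
  rewrite -!mulr_sumr fourier_diff_count // fourier_indicator fourier_delta.
  by ring.
exists #|D|, (diff_count D d0), (diff_count D z0); split.
- split=> [x|x y]; first by rewrite /cayley subrr (negPf D0).
  by rewrite /cayley -symD opprB.
- split; first by exists d0, 0; rewrite /cayley subr0.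
  by exists z0, 0; rewrite /cayley subr0.
- move=> x; rewrite -[RHS](card_imset _ (inj_comp (addrI x) oppr_inj)).
  apply: eq_card => y; rewrite inE /cayley; apply/idP/imsetP=> [xyD|[d dD ->]].
    by exists (x - y) => //=; rewrite opprB subrKC.
  by rewrite /= opprD opprK addNKr.
- move=> x y; rewrite /cayley card_common_nbr => xyD.
  apply/eqP; rewrite -(eqr_nat algC); apply/eqP.
  have := gC (x - y) d0; rewrite /g xyD d0D.
  have nz w : w \in D -> w == 0 = false by apply: contraTF => /eqP->.
  by rewrite !nz // mulr0 !addr0 => /addIr.
move=> x y xy; rewrite /cayley card_common_nbr => xyD.
apply/eqP; rewrite -(eqr_nat algC); apply/eqP.
have := gC (x - y) z0; rewrite /g (negPf xyD) (negPf z0D).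
by rewrite subr_eq0 (negPf xy) (negPf z0n0) !mulr0 !addr0 !subr0.
Qed.

End AdditiveCharacter.

(** * Norm and trace of a quadratic extension *)

Section QuadraticExtension.

Variables (K L : finFieldType) (iota : {rmorphism K -> L}).
Hypothesis cardL : #|L| = (#|K| ^ 2)%N.

Local Notation Q := #|K|.

Lemma frobD (x y : L) : (x + y) ^+ Q = x ^+ Q + y ^+ Q.
Proof.
have [p pr_p pcharKp] := finPcharP K.
apply: exprDn_pchar.
have pcharLp : p \in [pchar L] by apply: (rmorph_pchar iota).
rewrite (eq_pnat _ (pcharf_eq pcharLp)).
by have := pprimeChar_pgroup pcharKp; rewrite /pgroup cardsT.
Qed.

(** The image of [iota] consists of Q roots of X^Q - X, which has no more than Q roots. *)
Lemma frob_fixed (x : L) : x ^+ Q = x -> exists c, x = iota c.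
Proof.
move=> xQ; suff : x \in [set iota c | c in K] by case/imsetP=> c _ ->; exists c.
suff -> : [set iota c | c in K] = [set x | x ^+ Q == x] by rewrite inE xQ.
apply/eqP; rewrite eqEcard; apply/andP; split.
  by apply/subsetP=> _ /imsetP[c _ ->]; rewrite inE -rmorphXn expf_card.
rewrite card_imset; last exact: fmorph_inj.
have Q1 : (1 < Q)%N := finNzRing_gt1 K.
have szp : size ('X^Q - 'X : {poly L}) = Q.+1.
  by rewrite size_polyDl ?size_polyXn // size_polyN size_polyX.
rewrite -ltnS -szp cardE; apply: max_poly_roots (enum_uniq _).
  by rewrite -size_poly_eq0 szp.
apply/allP=> y; rewrite mem_enum inE rootE !hornerE => /eqP->.
by rewrite subrr.
Qed.

Lemma frobK (x : L) : (x ^+ Q) ^+ Q = x.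
Proof. by rewrite -exprM mulnn -cardL expf_card. Qed.

(** Under [cardL] the default 0 is never reached, here or in [rel_norm]: x + x^Q and x x^Q are fixed
    by Frobenius, hence lie in the image of [iota]. *)
Definition rel_trace (x : L) : K := odflt 0 [pick c | iota c == x + x ^+ Q].

Definition rel_norm (x : L) : K := odflt 0 [pick c | iota c == x * x ^+ Q].

Lemma rel_traceE x : iota (rel_trace x) = x + x ^+ Q.
Proof.
rewrite /rel_trace; case: pickP => [c /eqP //|no].
have [|c xc] := @frob_fixed (x + x ^+ Q); first by rewrite frobD frobK addrC.
by have := no c; rewrite -xc eqxx.
Qed.

Lemma rel_normE x : iota (rel_norm x) = x * x ^+ Q.
Proof.
rewrite /rel_norm; case: pickP => [c /eqP //|no].
have [|c xc] := @frob_fixed (x * x ^+ Q); first by rewrite exprMn frobK mulrC.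
by have := no c; rewrite -xc eqxx.
Qed.

Lemma rel_traceD : {morph rel_trace : x y / x + y}.
Proof.
move=> x y; apply: (fmorph_inj iota).
by rewrite rmorphD !rel_traceE frobD addrACA.
Qed.

Lemma rel_trace0 : rel_trace 0 = 0.
Proof. by apply: (addrI (rel_trace 0)); rewrite -rel_traceD !addr0. Qed.

Lemma rel_normM : {morph rel_norm : x y / x * y}.
Proof.
move=> x y; apply: (fmorph_inj iota).
by rewrite rmorphM !rel_normE exprMn mulrACA.
Qed.

Lemma rel_norm_eq0 x : (rel_norm x == 0) = (x == 0).
Proof.
by rewrite -(fmorph_eq0 iota) rel_normE -exprS expf_eq0.
Qed.

Lemma rel_norm1 : rel_norm 1 = 1.
Proof. by apply: (fmorph_inj iota); rewrite rel_normE expr1n mulr1 rmorph1. Qed.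

Lemma rel_normN1 : rel_norm (- 1) = 1.
Proof.
apply: (fmorph_inj iota).
have QN1 : (- 1) ^+ Q = - 1 :> L.
  by rewrite -(rmorphN1 iota) -rmorphXn expf_card.
by rewrite rel_normE QN1 mulrNN mulr1 rmorph1.
Qed.

(** * Counting elements of given trace and norm *)

Definition fibre (t n : K) : {set L} :=
  [set x | (rel_trace x == t) && (rel_norm x == n)].

(** The pairs (u, v) with u + v = t and u v = n, recorded by u alone: the analogue of [fibre] for
    the split algebra K x K. *)
Definition split_fibre (t n : K) : {set K} := [set u | u * (t - u) == n].

(* Points of either fibre are roots of X^2 - t X + n in L; a common point is
   fixed by Frobenius, hence a double root. *)
Lemma fibre_card_le t n : (#|fibre t n| + #|split_fibre t n| <= 2)%N.
Proof.
pose r := [set x : L | x * (iota t - x) == iota n].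
have r2 : (#|r| <= 2)%N.
  pose P : {poly L} := 'X^2 - (iota t *: 'X - (iota n)%:P).
  have szP : size P = 3%N.
    rewrite size_polyDl ?size_polyXn // size_polyN.
    rewrite (leq_ltn_trans (size_polyD _ _)) // size_polyN gtn_max.
    rewrite (leq_ltn_trans (size_scale_leq _ _)) ?size_polyX //.
    by rewrite (leq_ltn_trans (size_polyC_leq1 _)).
  rewrite -ltnS -szP cardE; apply: max_poly_roots (enum_uniq _).
    by rewrite -size_poly_eq0 szP.
  apply/allP=> y; rewrite mem_enum inE rootE !hornerE => /eqP<-.
  by apply/eqP; ring.
have Ar x : x \in fibre t n -> x \in r.
  rewrite !inE => /andP[/eqP<- /eqP<-].
  by rewrite rel_traceE rel_normE addrC addKr.
have Br : [set iota u | u in split_fibre t n] \subset r.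
  apply/subsetP=> _ /imsetP[u + ->]; rewrite !inE => /eqP<-.
  by rewrite rmorphM rmorphB.
rewrite -(card_imset _ (fmorph_inj iota)) -cardsUI.
have [/eqP I0|] := boolP (fibre t n :&: [set iota u | u in split_fibre t n] == set0).
  rewrite I0 cards0 addn0 (leq_trans _ r2) // subset_leq_card // subUset Br andbT.
  exact/subsetP.
case/set0Pn=> x /setIP[xA /imsetP[c _ xc]].
(* With r reduced to one point, the union and the intersection of the two fibres contribute at most
   1 each. *)
suff r1 : r \subset [set x].
  rewrite -[2%N]/(1 + 1)%N leq_add // -(cards1 x) subset_leq_card //.
    by rewrite subUset (subset_trans Br r1) (subset_trans _ r1) //; apply/subsetP.
  by rewrite (subset_trans _ r1) // (subset_trans _ Br) // subsetIr.
have xQ : x ^+ Q = x by rewrite xc -rmorphXn expf_card.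
apply/subsetP=> y; rewrite !inE.
move: xA; rewrite inE => /andP[/eqP<- /eqP<-].
rewrite rel_traceE rel_normE xQ -subr_eq0.
have -> : y * (x + x - y) - x * x = - ((y - x) ^+ 2) by ring.
by rewrite oppr_eq0 sqrf_eq0 subr_eq0.
Qed.

Lemma sum_split_fibre t : (\sum_n #|split_fibre t n| = Q)%N.
Proof.
rewrite -[RHS]sum1_card [RHS](partition_big (fun u => u * (t - u)) xpredT) //=.
by apply: eq_bigr => n _; rewrite -sum1_card; apply: eq_bigl => u; rewrite inE.
Qed.

Lemma sum_fibre : (\sum_t \sum_n #|fibre t n| = Q ^ 2)%N.
Proof.
rewrite -cardL -[RHS]sum1_card [RHS](partition_big rel_trace xpredT) //=.
apply: eq_bigr => t _; rewrite [RHS](partition_big rel_norm xpredT) //=.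
by apply: eq_bigr => n _; rewrite -sum1_card; apply: eq_bigl => x; rewrite inE.
Qed.

(* Both families of fibres have Q^2 points in total, so the bound by 2 for each
   of the Q^2 pairs (t, n) is attained everywhere. *)
Lemma fibre_card t n : (#|fibre t n| + #|split_fibre t n| = 2)%N.
Proof.
have /leqif_sum le2 : forall p : K * K, xpredT p ->
    (#|fibre p.1 p.2| + #|split_fibre p.1 p.2| <= 2
       ?= iff (#|fibre p.1 p.2| + #|split_fibre p.1 p.2| == 2))%N.
  by move=> p _; split; first exact: fibre_card_le.
have [_] := le2; rewrite big_split /=.
rewrite -(pair_bigA _ (fun t n => #|fibre t n|)).
rewrite -(pair_bigA _ (fun t n => #|split_fibre t n|)) /=.
rewrite sum_fibre (eq_bigr _ (fun t _ => sum_split_fibre t)) !sum_nat_const.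
rewrite card_prod mulnn addnn muln2 eqxx => /esym/forallP/(_ (t, n)) /=.
by move/eqP.
Qed.

(** Group both sums by (t, n). By [fibre_card] they add up to 2 (sum of g) (sum of psi), and the
    last factor is 0. *)
Lemma sum_rel_norm_trace (psi g : K -> algC) : additive_char psi ->
  \sum_x g (rel_norm x) * psi (rel_trace x)
    = - \sum_u \sum_v g (u * v) * psi (u + v).
Proof.
move=> psiP; apply/eqP; rewrite -addr_eq0; apply/eqP.
have -> : \sum_x g (rel_norm x) * psi (rel_trace x)
    = \sum_t \sum_n #|fibre t n|%:R * (g n * psi t).
  rewrite (partition_big rel_trace xpredT) //=; apply: eq_bigr => t _.
  rewrite (partition_big rel_norm xpredT) //=; apply: eq_bigr => n _.
  rewrite (eq_bigr (fun=> g n * psi t)); last by move=> x /andP[/eqP-> /eqP->].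
  by rewrite sumr_const mulr_natl; congr (_ *+ _); apply: eq_card => x; rewrite inE.
have -> : \sum_u \sum_v g (u * v) * psi (u + v)
    = \sum_t \sum_n #|split_fibre t n|%:R * (g n * psi t).
  transitivity (\sum_u \sum_t g (u * (t - u)) * psi t).
    apply: eq_bigr => u _; rewrite (reindex_inj (addIr (- u))) /=.
    by apply: eq_bigr => t _; rewrite subrKC.
  rewrite exchange_big; apply: eq_bigr => t _ /=.
  rewrite (partition_big (fun u => u * (t - u)) xpredT) //=.
  apply: eq_bigr => n _.
  rewrite (eq_bigr (fun=> g n * psi t)); last by move=> u /eqP->.
  by rewrite sumr_const mulr_natl; congr (_ *+ _); apply: eq_card => u; rewrite inE.
rewrite -big_split /=.
under eq_bigr do (rewrite -big_split /=; under eq_bigr do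
  rewrite -mulrDl -natrD fibre_card mulrA; rewrite -mulr_suml).
rewrite -mulr_sumr -(eq_bigr _ (fun t _ => congr1 psi (mul1r t))).
by rewrite (additive_char_sum psiP) oner_eq0 mulr0.
Qed.

(** Nontriviality needs an element of trace t where psi t != 1. If there were none, each
    [split_fibre t n] would have 2 elements, giving 2 Q in total instead of Q. *)
Lemma rel_trace_additive_char (psi : K -> algC) :
  additive_char psi -> additive_char (psi \o rel_trace).
Proof.
case=> psi0 psiD [t nt]; split; first by rewrite /= rel_trace0.
  by move=> x y; rewrite /= rel_traceD psiD.
have [n /existsP[x]] : exists n, [exists x, x \in fibre t n].
  apply/existsP; apply: contraT; rewrite negb_exists => /forallP no.
  suff : (Q = Q * 2)%N by have := finNzRing_gt1 K; case: Q => // k _; lia.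
  rewrite -{1}(sum_split_fibre t) -sum_nat_const; apply: eq_bigr => n _.
  rewrite -(fibre_card t n); suff -> : fibre t n = set0 by rewrite cards0.
  by apply/setP=> x; move: (no n); rewrite negb_exists in_set0 =>
    /forallP/(_ x)/negPf.
by rewrite inE => /andP[/eqP xt _]; exists x; rewrite /= xt.
Qed.

(** If a nonzero n were not a norm, the sets [split_fibre t n] would have 2 Q elements altogether as
    t varies; but each u determines at most one t with u (t - u) = n. *)
Lemma rel_norm_surj n : exists x, rel_norm x = n.
Proof.
have [->|n0] := eqVneq n 0; first by exists 0; apply/eqP; rewrite rel_norm_eq0.
have [t /existsP[x]] : exists t, [exists x, x \in fibre t n]; last first.
  by rewrite inE => /andP[_ /eqP<-]; exists x.
apply/existsP; apply: contraT; rewrite negb_exists => /forallP no.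
suff : (Q * 2 <= Q)%N by have := finNzRing_gt1 K; case: Q => // k _; lia.
rewrite -sum_nat_const.
have -> : (\sum_(t in K) 2 = \sum_t #|split_fibre t n|)%N.
  apply: eq_bigr => t _; rewrite -(fibre_card t n).
  suff -> : fibre t n = set0 by rewrite cards0.
  by apply/setP=> x; move: (no t); rewrite negb_exists in_set0 =>
    /forallP/(_ x)/negPf.
have -> : (\sum_t #|split_fibre t n| = \sum_u #|[set t | (u * (t - u))%R == n]|)%N.
  under eq_bigr do rewrite -sum1dep_card big_mkcond.
  rewrite exchange_big; apply: eq_bigr => u _; rewrite -sum1dep_card.
  by rewrite [RHS]big_mkcond.
rewrite -[leqRHS]sum1_card leq_sum // => u _.
apply/card_le1_eqP=> s t; rewrite !inE => /eqP sn /eqP tn.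
have u0 : u != 0 by apply: contraNneq n0 => u0; rewrite -sn u0 mul0r.
by apply: (addIr (- u)); apply: (mulfI u0); rewrite sn tn.
Qed.

End QuadraticExtension.

(** * Gauss periods of a multiplicative subgroup C *)

Section GaussPeriods.

Variables (K : finFieldType) (psi : K -> algC) (C : {set K}).
Hypotheses (psiP : additive_char psi).
Hypotheses (C0 : 0 \notin C) (C1 : 1 \in C) (CN1 : - 1 \in C).
Hypotheses (CM : forall x y, x \in C -> y \in C -> x * y \in C).
Hypotheses (CV : forall x, x \in C -> x^-1 \in C).
Hypotheses (srgC : strongly_regular (cayley C)).

Local Notation eta := (fourier_set psi C).
Local Notation k := (#|C|%:R : algC).

Let nz s : s \in C -> s != 0.
Proof. by apply: contraTneq => ->. Qed.

Let memCM s x : s \in C -> (x * s \in C) = (x \in C).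
Proof.
move=> sC; apply/idP/idP=> [xsC|xC]; last exact: CM.
by rewrite -(mulfK (nz sC) x) CM ?CV.
Qed.

Let memCN x : (- x \in C) = (x \in C).
Proof. by rewrite -mulrN1 memCM. Qed.

Lemma period_invariant s y : s \in C -> eta (y * s) = eta y.
Proof.
move=> sC; rewrite /fourier_set [RHS](reindex_inj (mulIf (nz sC))) /=.
by apply: eq_big => [x|x _]; rewrite ?memCM // mulrA mulrAC.
Qed.

Lemma period0 : eta 0 = k.
Proof.
have [psi0 _ _] := psiP; rewrite -sumr_const.
by apply: eq_bigr => x _; rewrite mul0r psi0.
Qed.

Lemma sum_period : \sum_u eta u = 0.
Proof.
rewrite exchange_big big1 // => s sC.
under eq_bigr do rewrite mulrC.
by rewrite (additive_char_sum psiP) (negPf (nz sC)).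
Qed.

(** After expanding both periods, orthogonality keeps only the pairs s' = - b s in C; each s has
    exactly one such s' if b is in C, and none otherwise. *)
Lemma period_correlation b :
  \sum_u eta (u * b) * eta u = #|K|%:R * k * (b \in C)%:R.
Proof.
have [_ psiD _] := psiP.
transitivity (\sum_(s in C) \sum_(s' in C) \sum_u psi ((b * s + s') * u)).
  rewrite /fourier_set; under eq_bigr do rewrite mulr_suml.
  rewrite exchange_big; apply: eq_bigr => s _ /=.
  under eq_bigr do rewrite mulr_sumr.
  rewrite exchange_big; apply: eq_bigr => s' _ /=.
  by apply: eq_bigr => u _; rewrite -psiD; congr psi; ring.
transitivity (\sum_(s in C) #|K|%:R * (b \in C)%:R : algC); last first.
  by rewrite sumr_const -[_ *+ #|C|]mulr_natr mulrAC.
apply: eq_bigr => s sC; rewrite -(memCM b sC) -memCN.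
have [bC|bC] := boolP (- (b * s) \in C); last first.
  rewrite mulr0 big1 // => s' s'C; rewrite (additive_char_sum psiP) addrC addr_eq0.
  by case: eqP => // s'E; rewrite -s'E s'C in bC.
rewrite (bigD1 (- (b * s))) //= [X in _ + X]big1 => [|s' /andP[_ ns']].
  by rewrite addr0 (additive_char_sum psiP) subrr eqxx mulr1.
by rewrite (additive_char_sum psiP) addrC addr_eq0 (negPf ns').
Qed.

Definition other_period (y : K) : bool := (y != 0) && (eta y != eta 1).

Lemma other_periodM s y : s \in C -> other_period (y * s) = other_period y.
Proof.
move=> sC; rewrite /other_period period_invariant //.
by rewrite mulf_eq0 (negPf (nz sC)) orbF.
Qed.

(** If eta equalled eta 1 on all of K*, the indicator of C minus eta 1 times the delta at 0 would be
    constant. It is 1 at 1, but 0 at the difference of two distinct nonadjacent vertices. *)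
Lemma exists_other_period : exists y, other_period y.
Proof.
apply/existsP; apply: contraT; rewrite negb_exists => /forallP no.
have gC : forall x y : K, (x \in C)%:R - eta 1 * (x == 0)%:R
    = (y \in C)%:R - eta 1 * (y == 0)%:R :> algC.
  apply: (fourier_const psiP) => a a0.
  transitivity (\sum_x (x \in C)%:R * psi (a * x)
    + \sum_x (- eta 1) * ((x == 0)%:R * psi (a * x))).
    by rewrite -big_split; apply: eq_bigr => x _ /=; ring.
  rewrite -mulr_sumr fourier_indicator (fourier_delta psiP).
  by move: (no a); rewrite /other_period a0 negbK => /eqP->; rewrite mulr1 addrN.
have [? [? [? [_ [_ [x [y [xy /negPf xyC]]]] _ _ _]]]] := srgC.
move: (gC 1 (x - y)).
rewrite /cayley in xyC.
rewrite xyC C1 subr_eq0 (negPf xy) oner_eq0 !mulr0 !subr0 => /eqP.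
by rewrite oner_eq0.
Qed.

(** All eta y with y != 0 are roots of one monic quadratic, whose roots sum to l - mu; this
    determines the root other than eta 1. *)
Lemma two_periods : exists beta,
  beta != eta 1 /\ forall y, other_period y -> eta y = beta.
Proof.
have [k' [l [mu srgC']]] := srgC.
have eqb y : other_period y -> eta y = l%:R - mu%:R - eta 1.
  case/andP=> y0 ny; have q1 := srg_fourier_quadratic psiP srgC' (oner_neq0 K).
  have qy := srg_fourier_quadratic psiP srgC' y0.
  have : (eta y - eta 1) * (eta y - (l%:R - mu%:R - eta 1)) = 0.
    transitivity (eta y ^+ 2 - eta 1 ^+ 2 - (l%:R - mu%:R) * (eta y - eta 1)).
      by ring.
    by rewrite q1 qy; ring.
  by move/eqP; rewrite mulf_eq0 !subr_eq0 (negPf ny) /= => /eqP.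
exists (l%:R - mu%:R - eta 1); split=> //.
by have [y /[dup] /eqb <- /andP[]] := exists_other_period.
Qed.

(* Averaging over C x C turns psi (u + v) into eta u * eta v, and the indicator
   of [other_period] is an affine function of eta away from 0; the correlation
   of eta with itself being a multiple of the indicator of C, the triple sum
   collapses to eta c. *)
Lemma sum_other_period beta c :
  beta != eta 1 -> (forall y, other_period y -> eta y = beta) -> c != 0 ->
  (beta - eta 1)
    * (\sum_u \sum_v (other_period (u * v / c))%:R * psi (u + v))
  = #|K|%:R * eta c + k - eta 1.
Proof.
move=> nb etab c0; have [_ psiD _] := psiP.
have k0 : k != 0 by rewrite pnatr_eq0 -lt0n; apply/card_gt0P; exists 1.
(* The last term corrects the affine formula at w = 0, where eta is k although 0 is excluded from
   [other_period]. *)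
have indE w : (beta - eta 1) * (other_period w)%:R
    = eta w - eta 1 - (k - eta 1) * (w == 0)%:R.
  case ow: (other_period w).
    by case/andP: (ow) => /negPf-> _; rewrite (etab _ ow) /=; ring.
  move: ow; rewrite /other_period; have [->|] := eqVneq w 0.
    by rewrite period0 => _ /=; ring.
  by move=> _ /= /negbFE/eqP->; ring.
set h := (X in _ * X = _).
have avg : k ^+ 2 * h
    = \sum_u \sum_v (other_period (u * v / c))%:R * (eta u * eta v).
  transitivity (\sum_(s in C) \sum_(s' in C) h).
    by rewrite !sumr_const -mulrnA -[RHS]mulr_natl natrM.
  transitivity (\sum_(s in C) \sum_(s' in C) \sum_u \sum_v
      (other_period (u * v / c))%:R * (psi (u * s) * psi (v * s'))).
    apply: eq_bigr => s sC; apply: eq_bigr => s' s'C.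
    rewrite /h (reindex_inj (mulIf (nz sC))); apply: eq_bigr => u _ /=.
    rewrite (reindex_inj (mulIf (nz s'C))); apply: eq_bigr => v _ /=.
    rewrite -psiD; congr (_%:R * _).
    have -> : u * s * (v * s') / c = u * v / c * (s * s') by ring.
    by rewrite other_periodM // CM.
  under eq_bigr do rewrite exchange_big.
  rewrite exchange_big; apply: eq_bigr => u _.
  under eq_bigr do rewrite exchange_big.
  rewrite exchange_big; apply: eq_bigr => v _.
  rewrite /fourier_set mulr_suml mulr_sumr; apply: eq_bigr => s _.
  by rewrite mulr_sumr mulr_sumr.
apply: (mulfI (expf_neq0 2 k0)); rewrite mulrCA avg.
transitivity (\sum_v eta v * (\sum_u eta (u * (v / c)) * eta u)
   - eta 1 * (\sum_u eta u * (\sum_v eta v))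
   - (k - eta 1) * (\sum_u eta u * \sum_v (u * v == 0)%:R * eta v)).
  have -> : \sum_v eta v * (\sum_u eta (u * (v / c)) * eta u)
      = \sum_u \sum_v eta (u * v / c) * eta u * eta v.
    rewrite exchange_big; apply: eq_bigr => v _; rewrite mulr_sumr.
    by apply: eq_bigr => u _; rewrite [RHS]mulrC -(mulrA u).
  rewrite !mulr_sumr -!sumrB; apply: eq_bigr => u _.
  rewrite !mulr_sumr -!sumrB; apply: eq_bigr => v _.
  rewrite [LHS]mulrA indE mulf_eq0 invr_eq0 (negPf c0) orbF; ring.
under eq_bigr do rewrite period_correlation.
rewrite sum_period -[\sum_u eta u * 0]mulr_suml mulr0 mulr0 subr0.
have -> : \sum_v eta v * (#|K|%:R * k * (v / c \in C)%:R)
    = #|K|%:R * k * (k * eta c).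
  transitivity (\sum_(v in C) #|K|%:R * k * eta c).
    rewrite (reindex_inj (mulIf c0)) [RHS]big_mkcond.
    apply: eq_bigr => v _; rewrite mulfK //.
    have [vC|_] := boolP (v \in C); last by rewrite !mulr0.
    by rewrite mulr1 [LHS]mulrC [v * c]mulrC period_invariant.
  by rewrite sumr_const -[LHS]mulr_natr; ring.
(* The inner sum is the total of eta, hence 0, for u = 0; for u != 0 only v = 0 contributes, giving
   eta 0 = k. What remains is k times the sum of eta over K*, which is - k. *)
have -> : \sum_u eta u * (\sum_v (u * v == 0)%:R * eta v) = - k ^+ 2.
  have zE : \sum_v (0 * v == 0)%:R * eta v = 0.
    by under eq_bigr do rewrite mul0r eqxx mul1r; rewrite sum_period.
  have nzE u : u != 0 -> \sum_v (u * v == 0)%:R * eta v = k.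
    move=> u0; rewrite (bigD1 0) //= mulr0 eqxx mul1r period0.
    rewrite [X in _ + X]big1 ?addr0 // => v v0.
    by rewrite mulf_eq0 (negPf u0) (negPf v0) mul0r.
  transitivity (\sum_u eta u * k - k * k); last first.
    by rewrite -mulr_suml sum_period; ring.
  rewrite (bigD1 0) //= zE mulr0 add0r [X in _ = X - _](bigD1 0) //= period0.
  rewrite addrAC subrr add0r.
  by apply: eq_bigr => u u0; rewrite nzE.
ring.
Qed.

(** * Strong regularity of the norm preimage *)

Variables (L : finFieldType) (iota : {rmorphism K -> L}).
Hypothesis cardL : #|L| = (#|K| ^ 2)%N.

Definition norm_preimage : {set L} :=
  [set x | other_period (rel_norm iota x)].

Lemma norm_preimage_srg : strongly_regular (cayley norm_preimage).
Proof.
have [beta [nb etab]] := two_periods.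
have nb0 : beta - eta 1 != 0 by rewrite subr_eq0.
have psiL := rel_trace_additive_char iota cardL psiP.
have [y oy] := exists_other_period; have [x xy] := rel_norm_surj iota cardL y.
pose eig z := - ((#|K|%:R * z + k - eta 1) / (beta - eta 1)).
(* The element x lies in the connection set by the choice of its norm; 1 lies outside it because its
   norm is 1 and eta 1 is the reference value. *)
apply: (@two_eigenvalues_srg _ _ psiL _ (eig (eta 1)) (eig beta) x 1).
- move=> d; rewrite !inE -mulN1r (rel_normM iota cardL).
  by rewrite (rel_normN1 iota cardL) mul1r.
- have := rel_norm_eq0 iota cardL 0; rewrite eqxx => /eqP N0.
  by rewrite inE N0 /other_period eqxx.
- by rewrite inE xy.
- exact: oner_neq0.
- by rewrite inE (rel_norm1 iota cardL) /other_period eqxx andbF.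
move=> a a0; set c := rel_norm iota a.
have c0 : c != 0 by rewrite (rel_norm_eq0 iota cardL).
have -> : fourier_set (psi \o rel_trace iota) norm_preimage a = eig (eta c).
  rewrite /eig -(sum_other_period nb etab c0) mulrC mulKf //.
  rewrite -(sum_rel_norm_trace iota cardL (fun w => (other_period (w / c))%:R) psiP).
  (* Substituting a z for the summation variable moves a into the trace and cancels c = N a against
     N (a z). *)
  rewrite /fourier_set big_mkcond [RHS](reindex_inj (mulfI a0)) /=.
  apply: eq_bigr => z _.
  rewrite (rel_normM iota cardL) -/c mulrAC mulfV // mul1r inE.
  by case: other_period; rewrite ?mul1r ?mul0r.
have [oc|] := boolP (other_period c); first by rewrite (etab c oc) subrr mulr0.
by rewrite /other_period c0 negbK => /eqP->; rewrite subrr mul0r.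
Qed.

End GaussPeriods.

(** * The trace of K over F *)

Section FieldTrace.

Variables (F : finFieldType) (K : splittingFieldType F).

Local Notation Tr := (galTrace 1 {: K}).

Lemma galTraceZ (c : F) (x : K) : Tr (c *: x) = c *: Tr x.
Proof. by rewrite scaler_sumr; apply: eq_bigr => s _; rewrite linearZ. Qed.

Lemma galTrace_scalar (x : K) : exists c : F, Tr x = c%:A.
Proof.
have := mem_galTrace (finField_galois (sub1v {:K}%AS)) (memvf x).
by case/vlineP=> c ->; exists c.
Qed.

(** Linear independence of the Galois automorphisms: the combination with all coefficients 1 is not
    the zero map. *)
Lemma galTrace_neq0 : exists x : K, Tr x != 0.
Proof.
have [x _ nx] := @gal_independent_contra _ _ {:K}%AS [in 'Gal({:K} / 1)]
  (fun=> 1) _ (group1 _) (oner_neq0 K).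
by exists x; move: nx; under eq_bigr do rewrite mul1r.
Qed.

End FieldTrace.

Lemma uvalM (R : finUnitRingType) (u v : {unit R}) :
  FinRing.uval (u * v)%g = FinRing.uval u * FinRing.uval v.
Proof. by []. Qed.

Lemma uvalX (R : finUnitRingType) (u : {unit R}) n :
  FinRing.uval (u ^+ n)%g = FinRing.uval u ^+ n.
Proof. exact: FinRing.val_unitX. Qed.

Lemma uval_neq0 (R : finFieldType) (u : {unit R}) : FinRing.uval u != 0.
Proof. by rewrite -unitfE; apply: (valP u). Qed.

Lemma unit_field_abelian (R : finFieldType) : abelian [set: {unit R}].
Proof. exact/cyclic_abelian/field_unit_group_cyclic. Qed.

Lemma unit_mulC (R : finFieldType) (u v : {unit R}) : (u * v = v * u)%g.
Proof. by apply: val_inj; apply: mulrC. Qed.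

(** * Counting trace-zero elements with a character *)

Section TraceZeroCount.

Variables (F : finFieldType) (K : fieldExtType F).

Local Notation K' := (finvect_type K).
Local Notation Tr := (galTrace 1 {: K'}).
Local Notation B := (base_units K).

Definition trace0_units : {set {unit K'}} :=
  [set u : {unit K'} | Tr (FinRing.uval u) == 0].

Lemma sum_base_units (h : K' -> algC) :
  \sum_(b in B) h (FinRing.uval b) = \sum_(c : F | c != 0) h c%:A.
Proof.
transitivity (\sum_(y in uset B) h y).
  by rewrite /uset big_imset //; apply: in2W; apply: val_inj.
transitivity (\sum_(y in [set (c%:A : K') | c in [pred c : F | c != 0]]) h y).
  apply: eq_bigl => y; apply/imsetP/imsetP=> [[b + ->]|[c c0 ->]].
    rewrite inE => /vlineP[c bc]; exists c => //; rewrite inE.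
    by apply: contraNneq (uval_neq0 b) => c0; rewrite bc c0 scale0r.
  have cu : (c%:A : K') \is a GRing.unit by rewrite unitfE scaler_eq0 oner_eq0 orbF.
  by exists (FinRing.unit K' cu) => //; rewrite inE rpredZ ?rpred1.
rewrite big_imset; first by apply: eq_bigl => c; rewrite inE.
by move=> c d _ _; apply: (fmorph_inj (in_alg K')).
Qed.

(** Compose a nontrivial character chi of F with the trace. On the orbit F* x the values are chi (c
    Tr x), so orthogonality over F, less the term c = 0, gives the formula. *)
Lemma exists_trace_char : exists psi : K' -> algC,
  additive_char psi /\ forall x : K',
    \sum_(b in B) psi (FinRing.uval b * x) = #|F|%:R * (Tr x == 0)%:R - 1.
Proof.
have [chi chiP] := exists_additive_char F.
pose tr (x : K') : F := odflt 0 [pick c | c%:A == Tr x].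
have trE x : (tr x)%:A = Tr x.
  rewrite /tr; case: pickP => [c /eqP //|no].
  by have [c xc] := galTrace_scalar x; have := no c; rewrite xc eqxx.
have inj : injective (fun c : F => c%:A : K') by apply: (fmorph_inj (in_alg K')).
have trZ c x : tr (c *: x) = c * tr x.
  by apply: inj; rewrite /= trE galTraceZ -scalerA trE.
have [chi0 chiD [c0 nc0]] := chiP.
exists (chi \o tr); split; first split.
- by rewrite /= -[X in tr X](scale0r (0 : K')) trZ mul0r.
- move=> x y; rewrite /= -chiD; congr chi; apply: inj.
  by rewrite /= scalerDl !trE raddfD.
- have [x nx] := galTrace_neq0 K'.
  have tx0 : tr x != 0 by apply: contraNneq nx => tx; rewrite -trE tx scale0r.
  by exists ((c0 / tr x) *: x); rewrite /= trZ divfK.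
move=> x; rewrite (sum_base_units (fun b => (chi \o tr) (b * x))).
transitivity (\sum_c chi (tr x * c) - 1).
  rewrite [in RHS](bigD1 0) //= mulr0 chi0 addrAC subrr add0r.
  by apply: eq_bigr => c _; rewrite /= -scalerAl mul1r trZ mulrC.
rewrite (additive_char_sum chiP) -trE scaler_eq0 oner_eq0 orbF; congr (_ - _).
by case: eqP; rewrite ?mulr1 ?mulr0.
Qed.

(** As X is stable under B, the factor |B| can be absorbed by averaging over B-orbits, each of which
    detects whether the trace vanishes. *)
Lemma sum_trace_char (psi : K' -> algC) (X : {set {unit K'}}) :
  (forall x : K',
    \sum_(b in B) psi (FinRing.uval b * x) = #|F|%:R * (Tr x == 0)%:R - 1) ->
  (forall b x, b \in B -> (b * x \in X)%g = (x \in X)) ->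
  #|B|%:R * \sum_(x in X) psi (FinRing.uval x)
    = #|F|%:R * #|trace0_units :&: X|%:R - #|X|%:R.
Proof.
move=> psiB BX.
transitivity (\sum_(b in B) \sum_(x in X) psi (FinRing.uval b * FinRing.uval x)).
  rewrite mulr_natl -sumr_const; apply: eq_bigr => b bB.
  by rewrite (reindex_inj (mulgI b)); apply: eq_bigl => x; apply: BX.
rewrite exchange_big /=; under eq_bigr do rewrite psiB.
rewrite sumrB sumr_const -mulr_sumr; congr (_ * _ - _).
rewrite -sumr_const (big_setID trace0_units) /= [X in _ + X]big1 ?addr0.
  by rewrite setIC; apply: eq_bigr => x; rewrite !inE => /andP[->].
by move=> x; rewrite !inE => /andP[/negPf->].
Qed.

End TraceZeroCount.

(** Both sets are unions of B-cosets, so their intersection consists of the full cosets common to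
    the two quotients. *)
Lemma card_quotientI (gT : finGroupType) (B : {group gT}) (S X : {set gT}) :
  [set: gT] \subset 'N(B) ->
  (forall b x, b \in B -> (b * x \in S)%g = (x \in S)) ->
  (forall b x, b \in B -> (b * x \in X)%g = (x \in X)) ->
  #|S :&: X| = (#|(S / B) :&: (X / B)|%g * #|B|)%N.
Proof.
move=> nB BS BX.
have nBx x : x \in 'N(B) by rewrite (subsetP nB).
have fib x y : coset B x = coset B y -> exists2 b, b \in B & x = (b * y)%g.
  by move=> /(rcoset_kercosetP (nBx x) (nBx y))/rcosetP[b bB ->]; exists b.
have mem_q (Y : {set gT}) : (forall b x, b \in B -> (b * x \in Y)%g = (x \in Y)) ->
    forall x, (coset B x \in Y / B)%g = (x \in Y).
  move=> BY x; apply/imsetP/idP=> [[y /setIP[_ yY] xy]|xY]; last first.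
    by exists x; rewrite // in_setI nBx.
  by have [b bB ->] := fib _ _ xy; rewrite BY.
rewrite -sum1_card (partition_big (coset B) [in (S / B) :&: (X / B)]%g) /=.
  rewrite -sum_nat_const; apply: eq_bigr => c.
  have [x _ ->] := cosetP c.
  rewrite inE !mem_q // => /andP[xS xX]; rewrite sum1_card -(card_rcoset B x).
  apply: eq_card => y; rewrite -[y \in _]/((y \in S :&: X) && (coset B y == coset B x)).
  apply/andP/rcosetP=> [[_ /eqP /fib //]|[b bB ->]].
  by rewrite inE BS // BX // xS xX coset_kerl.
by move=> x; rewrite !inE !mem_q.
Qed.

Lemma card_finvect (F : finFieldType) (K : fieldExtType F) :
  #|finvect_type K| = (#|F| ^ \dim {: K})%N.
Proof.
rewrite -(@card_vspacef F (finvect_type K) (Vector.class (finvect_type K))).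
exact: card_vspace.
Qed.

(** * Periods and intersections with the Singer set *)

Section PeriodCount.

Variables (F : finFieldType) (K : fieldExtType F).

Local Notation K' := (finvect_type K).
Local Notation B := (base_units K).

Lemma period_lcoset (psi : K' -> algC) (C0 : {set {unit K'}}) (w : {unit K'}) :
  fourier_set psi (uset C0) (FinRing.uval w)
    = \sum_(x in (w *: C0)%g) psi (FinRing.uval x).
Proof.
rewrite /fourier_set /uset big_imset; last by apply: in2W; apply: val_inj.
rewrite /= [RHS](reindex_inj (mulgI w)); apply: eq_bigl => x.
by rewrite mem_lcoset mulKg.
Qed.

(** Up to the nonzero factor |B|, a period is an affine function of the intersection number with
    nonzero slope |F| |B|, so equality of periods is equality of counts. This identifies the index
    set of the theorem with [other_period]. *)
Lemma period_eq_count (psi : K' -> algC) (C0 : {group {unit K'}})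
    (w : {unit K'}) :
  (forall x : K', \sum_(b in B) psi (FinRing.uval b * x)
     = #|F|%:R * (galTrace 1 {: K'} x == 0)%:R - 1) ->
  B \subset C0 ->
  (fourier_set psi (uset C0) (FinRing.uval w) == fourier_set psi (uset C0) 1)
    = (#|singer_set K :&: (w *: C0) / B|%g == #|singer_set K :&: C0 / B|%g).
Proof.
move=> psiB BC0.
have Bpos : (0 < #|B|)%N by apply: cardG_gt0.
have B0 : #|B|%:R != 0 :> algC by rewrite pnatr_eq0 -lt0n.
have nB : [set: {unit K'}] \subset 'N(B).
  by apply: sub_abelian_norm; rewrite ?unit_field_abelian ?subsetT.
have BX v b x : b \in B -> (b * x \in v *: C0)%g = (x \in v *: C0)%g.
  move=> bB; rewrite !mem_lcoset mulgA (unit_mulC _ b) -mulgA.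
  by rewrite groupMl // (subsetP BC0).
have BS b x : b \in B -> (b * x \in trace0_units K)%g = (x \in trace0_units K).
  move=> bB; have b0 := uval_neq0 b; move: bB; rewrite !inE => /vlineP[c bc].
  have c0 : c != 0 by apply: contraNneq b0 => c0; rewrite bc c0 scale0r.
  by rewrite uvalM bc -scalerAl mul1r galTraceZ scaler_eq0 (negPf c0).
have count v : #|B|%:R * fourier_set psi (uset C0) (FinRing.uval v)
    = #|F|%:R * (#|singer_set K :&: (v *: C0) / B|%g * #|B|)%:R - #|C0|%:R.
  rewrite period_lcoset (sum_trace_char psiB (BX v)).
  by rewrite (card_quotientI nB BS (BX v)) card_lcoset.
have count1 : #|B|%:R * fourier_set psi (uset C0) 1
    = #|F|%:R * (#|singer_set K :&: C0 / B|%g * #|B|)%:R - #|C0|%:R.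
  by have := count 1%g; rewrite lcoset1.
rewrite -(inj_eq (mulfI B0)) count count1 (inj_eq (addIr _)).
rewrite (inj_eq (mulfI (card_finField_neq0 F))) eqr_nat.
by rewrite eqn_pmul2r.
Qed.

End PeriodCount.

Theorem theorem3p1 (p f m e : nat)
    (F : finFieldType) (K : fieldExtType F)
    (L : fieldExtType (finvect_type K))
    (C0 : {group {unit finvect_type K}})
    (gamma : {unit finvect_type L}) (omega : {unit finvect_type K}) :
  prime p -> (1 <= f)%N -> (3 <= m)%N ->
  #|F| = (p ^ f)%N -> \dim {: K} = m -> \dim {: L} = 2%N ->
  base_units K \subset C0 ->
  #|[set: {unit finvect_type K}] : C0|%g = e ->
  [set - x | x in uset C0] = uset C0 ->
  strongly_regular (cayley (uset C0)) ->
  generator [set: {unit finvect_type L}] gamma ->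
  (FinRing.uval omega)%:A = FinRing.uval gamma ^+ ((p ^ f) ^ m + 1) :> L ->
  let I : {set 'I_e} :=
    [set i : 'I_e |
      #|singer_set K :&: ((omega ^+ i) *: C0) / base_units K|%g
      != #|singer_set K :&: C0 / base_units K|%g] in
  let D : {set finvect_type L} :=
    uset (\bigcup_(i in I) ((gamma ^+ i) *: <[gamma ^+ e]>)%g) in
  strongly_regular (cayley D).
Proof.
move=> _ _ _ cardF dimK dimL BC0 idxC0 symC0 srgC0 genG omegaE I D.
have cardK : #|finvect_type K| = ((p ^ f) ^ m)%N.
  by rewrite card_finvect cardF dimK.
have cardL : #|finvect_type L| = (#|finvect_type K| ^ 2)%N.
  by rewrite (card_finvect L) dimL.
have [psi [psiP psiB]] := exists_trace_char K.
pose C := uset C0.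
have CP x : reflect (exists2 u, u \in C0 & x = FinRing.uval u) (x \in C).
  exact: imsetP.
have C0nz : 0 \notin C.
  by apply/CP=> -[u _ /esym/eqP]; rewrite (negPf (uval_neq0 u)).
have C1 : 1 \in C by apply/CP; exists 1%g; rewrite ?group1.
have CN1 : - 1 \in C by rewrite /C -symC0; apply/imsetP; exists 1.
have CM x y : x \in C -> y \in C -> x * y \in C.
  move=> /CP[u uC ->] /CP[v vC ->]; apply/CP; exists (u * v)%g => //.
  exact: groupM.
have CV x : x \in C -> x^-1 \in C.
  by move=> /CP[u uC ->]; apply/CP; exists (u^-1)%g; rewrite ?groupV.
pose iota : {rmorphism finvect_type K -> finvect_type L} := in_alg (finvect_type L).
(* What is left is to match the cyclotomic description of D with the norm: gamma^j has norm gamma^(j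
   (Q + 1)) = omega^j. *)
suff -> : D = norm_preimage psi C iota by apply: norm_preimage_srg.
have normX j :
    rel_norm iota (FinRing.uval (gamma ^+ j)%g) = FinRing.uval (omega ^+ j)%g.
  have normG : rel_norm iota (FinRing.uval gamma) = FinRing.uval omega.
    apply: (fmorph_inj iota); rewrite (rel_normE iota cardL) -exprS cardK.
    by rewrite -addn1; apply: esym; exact: omegaE.
  rewrite !uvalX; elim: j => [|j IHj].
    by rewrite !expr0 (rel_norm1 iota cardL).
  by rewrite !exprS (rel_normM iota cardL) IHj normG.
have e_gt0 : (0 < e)%N by rewrite -idxC0.
(* The quotient by C0 has order e, so every e-th power is trivial in it. *)
have omega_e : (omega ^+ e)%g \in C0.
  have nC : [set: {unit finvect_type K}] \subset 'N(C0).
    by apply: sub_abelian_norm; rewrite ?unit_field_abelian ?subsetT.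
  rewrite coset_idr ?morphX ?(subsetP nC) ?inE //=.
  by rewrite -idxC0 -card_quotient // expg_cardG // mem_quotient.
(* Since omega^e is in C0, the period at omega^j depends only on j modulo e, and residues below e
   are the indices of [I]. *)
have omegaI j (je : (j %% e < e)%N) :
    other_period psi C (FinRing.uval (omega ^+ j)%g) = (Ordinal je \in I).
  rewrite inE /= -(period_eq_count _ psiB BC0) /other_period uval_neq0 /=.
  rewrite {1}(divn_eq j e) mulnC expgD expgM unit_mulC uvalM.
  rewrite (period_invariant psi C0nz CM CV) //.
  by apply/CP; exists ((omega ^+ e) ^+ (j %/ e))%g => //; apply: groupX.
apply/setP=> x; rewrite [RHS]inE; apply/imsetP/idP=> [[u /bigcupP[i iI]]|].
  case/lcosetP=> _ /cycleP[n ->] -> ->.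
  rewrite -expgM -expgD normX.
  have lt_i : ((i + e * n) %% e < e)%N by rewrite ltn_mod.
  rewrite (omegaI _ lt_i); congr (_ \in I): iI; apply: val_inj => /=.
  by rewrite mulnC addnC modnMDl modn_small.
(* Conversely, x is nonzero, hence some gamma^j; the residue of j modulo e gives the index and the
   quotient gives the power of gamma^e. *)
move=> ox; have x0 : x != 0.
  by case/andP: ox; rewrite (rel_norm_eq0 iota cardL).
have xU : x \is a GRing.unit by rewrite unitfE.
pose u := FinRing.unit (finvect_type L) xU.
have /cycleP[j uj] : u \in <[gamma]>%g by rewrite -(eqP genG) inE.
have xE : x = FinRing.uval (gamma ^+ j)%g by rewrite -uj.
have lt_j : (j %% e < e)%N by rewrite ltn_mod.
exists (gamma ^+ j)%g => //; apply/bigcupP; exists (Ordinal lt_j).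
  by rewrite -omegaI -normX -xE.
apply/lcosetP; exists ((gamma ^+ e) ^+ (j %/ e))%g; first exact: mem_cycle.
by rewrite -expgM -expgD /= mulnC addnC -divn_eq.
Qed.
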